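(* Let $a_0,b_0>0$ and let $a,b$ be independent real random variables with Cauchy-Lorentz densities $$g_a(x)=\frac{1}{\pi a_0\left(1+x^2/a_0^2\right)},\qquad g_b(x)=\frac{1}{\pi b_0\left(1+x^2/b_0^2\right)}.$$ Let $S=2\sqrt{a^2+b^2}$ be the level spacing of the real symmetric random matrix $\begin{pmatrix} a & b\\ b & -a\end{pmatrix}$. Then $S$ has the probability density $$P(S)=\frac{S}{2\pi a_0b_0}\cdot\frac{\alpha^2\sqrt{1+\beta^2}+\beta^2\sqrt{1+\alpha^2}}{(\alpha^2+\beta^2+\alpha^2\beta^2)\sqrt{1+\alpha^2}\sqrt{1+\beta^2}},\qquad S>0,$$ where $\alpha^2=S^2/(4a_0^2)$ and $\beta^2=S^2/(4b_0^2)$. Moreover, as $S\to\infty$, $$P(S)\sim\frac{4(a_0+b_0)}{\pi S^2},$$ and the first moment $\int_0^\infty S\,P(S)\,dS$ is infinite.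
   Context: The matrix $\begin{pmatrix} a & b\\ b & -a\end{pmatrix}$ has real eigenvalues $\pm\sqrt{a^2+b^2}$; the level spacing is the difference of the two eigenvalues. The notation $f\sim h$ as $S\to\infty$ means $f(S)/h(S)\to1$. *)

(* Defs.v *)
From HB Require Import structures.
From mathcomp Require Import all_boot all_order all_algebra.
From mathcomp Require Import all_classical all_reals all_analysis.

Set Implicit Arguments.
Unset Strict Implicit.
Unset Printing Implicit Defensive.

Import Order.TTheory GRing.Theory Num.Theory.
Import numFieldNormedType.Exports.

Local Open Scope classical_set_scope.
Local Open Scope ring_scope.

Definition independent_RV {d : measure_display} {T : measurableType d}
    {R : realType} (P : probability T R) (X Y : {RV P >-> R}) : Prop :=
  forall A B : set R, measurable A -> measurable B ->
    P (X @^-1` A `&` Y @^-1` B) = (P (X @^-1` A) * P (Y @^-1` B))%E.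

Arguments independent_RV {d T R} P X Y.

(* Measurability of X is part of the definition, so that it can be concluded
   for a bare function X : T -> R. *)
Definition has_density {d : measure_display} {T : measurableType d}
    {R : realType} (P : probability T R) (X : T -> R) (f : R -> R) : Prop :=
  [/\ measurable_fun [set: T] X,
      measurable_fun [set: R] f,
      (forall x, 0 <= f x) &
      forall A : set R, measurable A ->
        P (X @^-1` A) = (\int[@lebesgue_measure R]_(x in A) (f x)%:E)%E].

Definition cauchy_pdf {R : realType} (c x : R) : R :=
  1 / (pi * c * (1 + x ^+ 2 / c ^+ 2)).

Definition sym_traceless_mx {R : realType} (a b : R) : 'M[R]_2 :=
  \matrix_(i, j) nth 0 (nth [::] [:: [:: a; b]; [:: b; - a]] i) j.

(* Largest minus smallest eigenvalue. When A is real symmetric, its spectrum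
   has one or two elements; a double eigenvalue gives spacing 0. *)
Definition level_spacing {R : realType} (A : 'M[R]_2) : R :=
  sup [set x | eigenvalue A x] - inf [set x | eigenvalue A x].

(* al2 and be2 stand for alpha^2 and beta^2. *)
Definition spacing_pdf {R : realType} (a0 b0 s : R) : R :=
  let al2 := s ^+ 2 / (4 * a0 ^+ 2) in
  let be2 := s ^+ 2 / (4 * b0 ^+ 2) in
  s / (2 * pi * a0 * b0) *
  ((al2 * Num.sqrt (1 + be2) + be2 * Num.sqrt (1 + al2)) /
   ((al2 + be2 + al2 * be2) * Num.sqrt (1 + al2) * Num.sqrt (1 + be2))).

(* Main.v *)
Require Import Defs.
From HB Require Import structures.
From mathcomp Require Import all_boot all_order all_algebra.
From mathcomp Require Import all_classical all_reals all_analysis.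
From mathcomp Require Import measurable_realfun.
From mathcomp Require Import ring lra.
Import Order.TTheory GRing.Theory Num.Theory.
Import numFieldNormedType.Exports.
Local Open Scope classical_set_scope.
Local Open Scope ring_scope.

(** The joint law of (a, b) has density g_a(x) g_b(y). In the coordinates
    (u, t) with x = u / sqrt(1 + t^2), y = u t / sqrt(1 + t^2), where t is the
    slope and u the signed radius, S becomes 2 |u|, and the Jacobian is
    |u| / (1 + t^2). With alpha, beta taken at S = 2 |u|, the integral over t is
    that of a rational function of t^2, which partial fractions reduce to two
    Lorentzians; this gives the density. The tail follows from writing P(S) as
    4 (a0 + b0) / (pi S^2) times a function of 1/S continuous at 0 with value 1,
    so S P(S) eventually dominates a multiple of 1/S. *)

(** * Eigenvalues and level spacing of the matrix *)

(** The matrix squares to [a ^+ 2 + b ^+ 2] times the identity, so applying the eigenvector relation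
    twice and comparing a nonzero coordinate gives one direction. The other needs an explicit
    eigenvector. *)
Lemma eigenvalue_sym_traceless {R : realType} (a b x : R) :
  eigenvalue (sym_traceless_mx a b) x <-> x ^+ 2 = a ^+ 2 + b ^+ 2.
Proof.
have mulE (v : 'rV[R]_2) : v *m sym_traceless_mx a b =
    \row_j (if j == 0 then v 0 0 * a + v 0 1 * b else v 0 0 * b - v 0 1 * a).
  apply/rowP => j; rewrite !mxE big_ord_recl big_ord1 !mxE/=.
  rewrite (_ : lift 0 0 = 1); last exact/val_inj.
  by case: j => -[|[|//]] ? /=; rewrite ?mulrN.
split=> [/eigenvalueP[v]|xE].
  rewrite mulE => /rowP E v0.
  have := E 0; have := E 1; rewrite !mxE/= => E1 E0.
  have [v00|v00] := eqVneq (v 0 0) 0; last first.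
    apply: (mulIf v00); rewrite expr2 -mulrA -E0.
    rewrite (_ : x * _ = x * v 0 0 * a + x * v 0 1 * b); last by ring.
    by rewrite -E0 -E1; ring.
  have [v01|v01] := eqVneq (v 0 1) 0.
    case/negP: v0; apply/eqP/rowP => j; rewrite mxE.
    case: j => -[|[|//]] jlt; [rewrite -v00|rewrite -v01]; congr (v _ _);
      exact/val_inj.
  apply: (mulIf v01); rewrite expr2 -mulrA -E1.
  rewrite (_ : x * _ = x * v 0 0 * b - x * v 0 1 * a); last by ring.
  by rewrite -E0 -E1; ring.
apply/eigenvalueP.
(* The row (x + a, b) satisfies the eigenvector relation for either root. It vanishes only if b = 0
   and x = -a, and then (0, 1) serves instead. *)
have [/andP[/eqP b0 /eqP xa]|nz] := boolP ((b == 0) && (x + a == 0)).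
  exists (\row_j (j == 1)%:R).
    rewrite mulE; apply/rowP => j; rewrite !mxE b0.
    have -> : x = - a by lra.
    by case: j => -[|[|//]] ? /=; rewrite ?mxE/=; ring.
  by apply/eqP => /rowP/(_ 1); rewrite !mxE/= => /eqP; rewrite oner_eq0.
exists (\row_j (if j == 0 then x + a else b)).
  rewrite mulE; apply/rowP => j; rewrite !mxE.
  case: j => -[|[|//]] ? /=; rewrite ?mxE/=; last by ring.
  by move: xE; lra.
apply: contraNneq nz => /rowP E; have := E 0; have := E 1.
by rewrite !mxE/= => -> ->; rewrite eqxx.
Qed.

Lemma level_spacing_sym_traceless {R : realType} (a b : R) :
  level_spacing (sym_traceless_mx a b) = 2 * Num.sqrt (a ^+ 2 + b ^+ 2).
Proof.
rewrite /level_spacing; set r := Num.sqrt _.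
have s0 : 0 <= a ^+ 2 + b ^+ 2 by rewrite addr_ge0 ?sqr_ge0.
have r0 : 0 <= r by exact: sqrtr_ge0.
(* For r = 0 this set is a single point; the computations of [sup] and [inf] below only use 0 <=
   r. *)
have -> : [set x | eigenvalue (sym_traceless_mx a b) x] = [set - r; r].
  apply/seteqP; split => x /=.
    move=> /eigenvalue_sym_traceless xE.
    have /eqP : x ^+ 2 = r ^+ 2 by rewrite sqr_sqrtr.
    by rewrite eqf_sqr => /orP[] /eqP ->; [right|left].
  by move=> H; apply/eigenvalue_sym_traceless; rewrite -(sqr_sqrtr s0) -/r;
    case: H => ->; rewrite ?sqrrN.
have ubr : ubound [set - r; r] r by move=> x [] ->; lra.
have lbr : lbound [set - r; r] (- r) by move=> x [] ->; lra.
have -> : sup [set - r; r] = r.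
  apply/le_anti/andP; split; first by apply: ge_sup => //; exists r; right.
  by apply: ub_le_sup; [exists r|right].
have -> : inf [set - r; r] = - r.
  apply/le_anti/andP; split; last by apply: lb_le_inf => //; exists r; right.
  by apply: ge_inf; [exists (- r)|left].
by ring.
Qed.

(** * Tail form of the density and its asymptotics *)

(* [s ^+ 2 * spacing_pdf a0 b0 s], normalised by its limit and written in the
   variable [x = s^-1], in which it is continuous at 0. *)
Definition spacing_tail {R : realType} (a0 b0 x : R) : R :=
  (b0 / Num.sqrt (1 + 4 * a0 ^+ 2 * x ^+ 2) +
   a0 / Num.sqrt (1 + 4 * b0 ^+ 2 * x ^+ 2)) /
  (1 + 4 * (a0 ^+ 2 + b0 ^+ 2) * x ^+ 2) / (a0 + b0).

Lemma sqrtr_gt0_oneD {R : realType} (x : R) : 0 <= x -> 0 < Num.sqrt (1 + x).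
Proof. by move=> x0; rewrite sqrtr_gt0 ltr_wpDr. Qed.

Lemma spacing_tail_coef_gt0 {R : realType} (a0 b0 s : R) :
  0 < a0 -> 0 < b0 -> 0 < s -> 0 < 4 * (a0 + b0) / (pi * s ^+ 2).
Proof.
move=> a00 b00 s0; apply: divr_gt0; apply: mulr_gt0 => //.
- exact: addr_gt0.
- exact: pi_gt0.
- exact: exprn_gt0.
Qed.

Lemma spacing_pdf_tail {R : realType} (a0 b0 s : R) :
  0 < a0 -> 0 < b0 -> 0 < s ->
  spacing_pdf a0 b0 s =
  4 * (a0 + b0) / (pi * s ^+ 2) * spacing_tail a0 b0 s^-1.
Proof.
move=> a00 b00 s0; have p0 := pi_gt0 R.
(* Pulling s / (2 c) out of the root leaves a factor that tends to 1 as s grows. *)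
have sqE c : 0 < c -> Num.sqrt (1 + s ^+ 2 / (4 * c ^+ 2)) =
    s / (2 * c) * Num.sqrt (1 + 4 * c ^+ 2 * s^-1 ^+ 2).
  move=> c0; rewrite -[s / (2 * c)]ger0_norm ?divr_ge0 ?mulr_ge0 ?ltW//.
  rewrite -sqrtr_sqr -sqrtrM ?sqr_ge0//; congr Num.sqrt.
  by field; rewrite ?gt_eqF.
rewrite /spacing_pdf /spacing_tail !sqE//.
have ge0 c : 0 <= 4 * c ^+ 2 * s^-1 ^+ 2 by exact: mulr_ge0 (mulr_ge0 _ (sqr_ge0 _)) (sqr_ge0 _).
have := sqrtr_gt0_oneD _ (ge0 a0); have := sqrtr_gt0_oneD _ (ge0 b0).
set A := Num.sqrt _; set B := Num.sqrt _ => A0 B0.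
move: (pi : R) p0 => p p0; clear sqE ge0; field.
(* [field] asks for nonzero sums of positive monomials; once the monomials are known to be positive,
   these goals are linear. *)
have a2 : 0 < a0 ^+ 2 by rewrite exprn_gt0.
have b2 : 0 < b0 ^+ 2 by rewrite exprn_gt0.
have s2 : 0 < s ^+ 2 by rewrite exprn_gt0.
have s4 : 0 < (s * s) ^+ 2 by rewrite exprn_gt0 ?mulr_gt0.
have sa : 0 < (s * a0) ^+ 2 by rewrite exprn_gt0 ?mulr_gt0.
have sb : 0 < (s * b0) ^+ 2 by rewrite exprn_gt0 ?mulr_gt0.
by do ?[apply/andP; split]; apply: lt0r_neq0 => //; lra.
Qed.

Lemma continuous_spacing_tail {R : realType} (a0 b0 : R) :
  0 < a0 -> 0 < b0 -> continuous (spacing_tail a0 b0).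
Proof.
move=> a00 b00 x.
have ge0 c y : 0 <= 4 * c ^+ 2 * y ^+ 2 :> R by exact: mulr_ge0 (mulr_ge0 _ (sqr_ge0 _)) (sqr_ge0 _).
have cq c : (1 + 4 * c * y ^+ 2) @[y --> x] --> 1 + 4 * c * x ^+ 2.
  by apply: cvgD; [exact: cvg_cst|apply: cvgM; [exact: cvg_cst|exact: exprn_continuous]].
have cs c : (Num.sqrt (1 + 4 * c ^+ 2 * y ^+ 2))^-1 @[y --> x] -->
    (Num.sqrt (1 + 4 * c ^+ 2 * x ^+ 2))^-1.
  apply: cvgV; first by rewrite gt_eqF// sqrtr_gt0_oneD.
  by apply: (cvg_comp _ _ (cq _)); exact: sqrt_continuous.
apply: cvgM; last exact: cvg_cst.
apply: cvgM; first by apply: cvgD; (apply: cvgM; [exact: cvg_cst|exact: cs]).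
apply: cvgV; last exact: cq.
rewrite gt_eqF// ltr_wpDr//.
by apply: mulr_ge0 (sqr_ge0 _); apply: mulr_ge0; rewrite ?addr_ge0 ?sqr_ge0.
Qed.

Lemma spacing_pdf_equiv {R : realType} (a0 b0 : R) : 0 < a0 -> 0 < b0 ->
  (spacing_pdf a0 b0 s / (4 * (a0 + b0) / (pi * s ^+ 2)))
    @[s --> +oo] --> (1 : R).
Proof.
move=> a00 b00.
have : spacing_tail a0 b0 s^-1 @[s --> +oo] --> spacing_tail a0 b0 0.
  apply: (@cvg_comp _ _ _ _ _ _ (nbhs 0) _); last exact: continuous_spacing_tail.
  by apply/gtr0_cvgV0; [exact: nbhs_pinfty_gt|exact: cvg_id].
(* At x = 0 both roots equal 1, which leaves (b0 + a0) / (a0 + b0). *)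
rewrite [X in _ --> X -> _](_ : _ = 1); last first.
  rewrite /spacing_tail !expr0n/= !mulr0 !addr0 sqrtr1 !divr1 (addrC b0).
  by rewrite divff// gt_eqF// addr_gt0.
apply: cvg_trans; apply: near_eq_cvg; near=> s.
have s0 : 0 < s by near: s; exact: nbhs_pinfty_gt.
rewrite spacing_pdf_tail// mulrAC divff ?mul1r//.
by rewrite gt_eqF// spacing_tail_coef_gt0.
Unshelve. all: by end_near. Qed.

(** * Divergence of the first moment *)

(** The integral dominates c (ln N - ln M) for every N > M, and the logarithm is unbounded. *)
Lemma integral_cst_div_pinfty {R : realType} (M c : R) : 0 < M -> 0 < c ->
  (\int[@lebesgue_measure R]_(s in `]M, +oo[) (c / s)%:E = +oo)%E.
Proof.
move=> M0 c0.
have cc x : M <= x -> {for x, continuous (fun s : R => c / s)}.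
  move=> Mx; apply: cvgM; first exact: cvg_cst.
  by apply: cvgV; [rewrite gt_eqF// (lt_le_trans M0)|exact: cvg_id].
have mc : measurable_fun `]M, +oo[ (EFin \o (fun s : R => c / s)).
  apply/measurable_EFinP; apply: open_continuous_measurable_fun => //.
  by move=> x /[!inE]/= /[!in_itv]/= /andP[/ltW xM _]; exact: cc.
have pos x : `]M, +oo[%classic x -> (0 <= (c / x)%:E)%E.
  rewrite /= in_itv/= andbT lee_fin => Mx.
  by rewrite divr_ge0 ?ltW// (lt_trans M0).
have lb N : M < N ->
    ((c * (ln N - ln M))%:E <= \int[@lebesgue_measure R]_(s in `]M, +oo[) (c / s)%:E)%E.
  move=> MN; have -> : ((c * (ln N - ln M))%:E =
      \int[@lebesgue_measure R]_(s in `[M, N]) (c / s)%:E)%E.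
    rewrite (@continuous_FTC2 _ _ (fun x => c * ln x)) ?mulrBr//.
    - apply: continuous_in_subspaceT => x /[!inE]/= /[!in_itv]/= /andP[Mx _].
      exact: cc.
    - have cl x : M <= x -> {for x, continuous (fun s : R => c * ln s)}.
        move=> Mx; apply: cvgM; first exact: cvg_cst.
        by apply: continuous_ln; rewrite (lt_le_trans M0).
      split.
      + move=> x /[!in_itv]/= /andP[Mx _].
        apply: derivableM => //; apply: ex_derive.
        by apply: is_derive1_ln; exact: lt_trans Mx.
      + by apply: cvg_at_right_filter; exact: cl.
      + by apply: cvg_at_left_filter; apply: cl; exact: ltW.
    - move=> x /[!in_itv]/= /andP[Mx _]; have x0 := lt_trans M0 Mx.
      have dl := is_derive1_ln x0.
      by rewrite derive1E deriveZ//= derive_val.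
  rewrite -(integral_itv_obnd_cbnd); last first.
    by apply: measurable_funS mc => //; apply: subset_itvl; rewrite bnd_simp.
  by apply: ge0_subset_integral => //; apply: subset_itvl; rewrite bnd_simp.
apply/eqyP => A A0.
(* This N solves c (ln N - ln M) = A. *)
pose N := M * expR (A / c).
have MN : M < N.
  by rewrite /N ltr_pMr// expR_gt1 divr_gt0.
apply: le_trans (lb _ MN); rewrite lee_fin /N lnM ?posrE ?expR_gt0// expRK.
by rewrite addrC addKr mulrCA divff ?gt_eqF// mulr1.
Qed.

Lemma spacing_pdf_gt0 {R : realType} (a0 b0 s : R) :
  0 < a0 -> 0 < b0 -> 0 < s -> 0 < spacing_pdf a0 b0 s.
Proof.
move=> a00 b00 s0; rewrite spacing_pdf_tail// mulr_gt0//.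
  exact: spacing_tail_coef_gt0.
have ge0 c : 0 <= 4 * c ^+ 2 * s^-1 ^+ 2 by exact: mulr_ge0 (mulr_ge0 _ (sqr_ge0 _)) (sqr_ge0 _).
rewrite !divr_gt0 ?addr_gt0 ?divr_gt0 ?sqrtr_gt0_oneD//.
apply: mulr_gt0; last by rewrite exprn_gt0 ?invr_gt0.
by rewrite mulr_gt0// addr_gt0 ?exprn_gt0.
Qed.

Lemma continuous_spacing_pdf {R : realType} (a0 b0 s : R) :
  0 < a0 -> 0 < b0 -> 0 < s -> {for s, continuous (spacing_pdf a0 b0)}.
Proof.
move=> a00 b00 s0.
have : (4 * (a0 + b0) / (pi * x ^+ 2) * spacing_tail a0 b0 x^-1) @[x --> s]
    --> 4 * (a0 + b0) / (pi * s ^+ 2) * spacing_tail a0 b0 s^-1.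
  apply: cvgM.
    apply: cvgM; first exact: cvg_cst.
    apply: cvgV; first by rewrite gt_eqF// mulr_gt0 ?pi_gt0 ?exprn_gt0.
    by apply: cvgM; [exact: cvg_cst|exact: exprn_continuous].
  apply: (@cvg_comp _ _ _ _ _ _ (nbhs s^-1) _); last exact: continuous_spacing_tail.
  by apply: cvgV; [rewrite gt_eqF|exact: cvg_id].
rewrite /prop_for /continuous_at -spacing_pdf_tail//.
(* The tail form is available only for positive arguments, hence equality merely near s. *)
apply: cvg_trans; apply: near_eq_cvg; near=> x.
rewrite spacing_pdf_tail//; near: x; exact: lt_nbhsr.
Unshelve. all: by end_near. Qed.

Lemma measurable_spacing_pdf {R : realType} (a0 b0 : R) :
  0 < a0 -> 0 < b0 -> measurable_fun (`]0%R, +oo[ : set R) (spacing_pdf a0 b0).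
Proof.
move=> a00 b00; apply: open_continuous_measurable_fun => // x.
by rewrite inE/= in_itv/= andbT => x0; exact: continuous_spacing_pdf.
Qed.

Lemma spacing_pdf_moment_pinfty {R : realType} (a0 b0 : R) :
  0 < a0 -> 0 < b0 ->
  (\int[@lebesgue_measure R]_(s in `]0%R, +oo[)
     (s * spacing_pdf a0 b0 s)%:E = +oo)%E.
Proof.
move=> a00 b00; have ab0 := addr_gt0 a00 b00.
have /cvgr_gt : (spacing_pdf a0 b0 s / (4 * (a0 + b0) / (pi * s ^+ 2)))
    @[s --> +oo] --> (1 : R) by exact: spacing_pdf_equiv.
move=> /(_ 2^-1); rewrite invf_lt1 ?ltr1n// => /(_ isT) near_half.
have [M /andP[M0 _] HM] : exists2 M : R, (0 < M) && true & forall s, M < s ->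
    2^-1 < spacing_pdf a0 b0 s / (4 * (a0 + b0) / (pi * s ^+ 2)).
  (* The maximum with 1 makes the threshold positive, as the comparison with c / s requires. *)
  case: near_half => M [_ HM]; exists (Num.max M 1).
    by rewrite lt_max ltr01 orbT.
  by move=> s; rewrite gt_max => /andP[Ms _]; exact: HM.
(* Half the tail constant: beyond M the density exceeds half its asymptote, so s P(s) >= c / s. *)
pose c := 2 * (a0 + b0) / pi : R.
have c0 : 0 < c by rewrite divr_gt0 ?mulr_gt0 ?pi_gt0.
apply/eqP; rewrite -leye_eq -(integral_cst_div_pinfty _ _ M0 c0).
have mf : measurable_fun (`]0%R, +oo[ : set R) (EFin \o (fun s : R => s * spacing_pdf a0 b0 s)).
  by apply/measurable_EFinP/measurable_funM => //; exact: measurable_spacing_pdf.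
have sub : (`]M, +oo[ : set R) `<=` `]0%R, +oo[.
  by apply: subset_itvr; rewrite bnd_simp ltW.
apply: (@le_trans _ _ (\int[@lebesgue_measure R]_(s in `]M, +oo[)
    (s * spacing_pdf a0 b0 s)%:E)%E); last first.
  apply: ge0_subset_integral => // x /=; rewrite in_itv/= andbT => x0.
  by rewrite lee_fin mulr_ge0 ?ltW// spacing_pdf_gt0.
apply: ge0_le_integral => //.
- move=> x /=; rewrite in_itv/= andbT => Mx.
  by rewrite lee_fin divr_ge0 ?ltW// (lt_trans M0).
- apply/measurable_EFinP; apply: open_continuous_measurable_fun => // x.
  rewrite inE/= in_itv/= andbT => Mx; apply: cvgM; first exact: cvg_cst.
  by apply: cvgV; [rewrite gt_eqF// (lt_trans M0)|exact: cvg_id].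
- exact: measurable_funS mf.
- move=> x /=; rewrite in_itv/= andbT => Mx; have x0 := lt_trans M0 Mx.
  have p0 := pi_gt0 R.
  have d0 := spacing_tail_coef_gt0 _ _ _ a00 b00 x0.
  have := HM _ Mx; rewrite ltr_pdivlMr// => /ltW H.
  rewrite lee_fin; apply: le_trans (ler_wpM2l (ltW x0) H).
  rewrite le_eqVlt; apply/orP; left; apply/eqP; rewrite /c.
  by move: (pi : R) p0 => p p0; field; rewrite !gt_eqF.
Qed.

(** * Linear substitutions in Lebesgue integrals *)

(** By uniqueness of Lebesgue measure, it suffices that c times the image measure under
    multiplication by c gives half-open intervals their length. *)
Lemma lebesgue_measure_scale {R : realType} (c : R) (A : set R) :
  0 < c -> measurable A ->
  lebesgue_measure A =
  (c%:E * lebesgue_measure (( *%R c) @^-1` A : set R))%E.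
Proof.
move=> c0 mA.
have mc : measurable_fun [set: measurableTypeR R]
  ( *%R c : measurableTypeR R -> measurableTypeR R) by exact: mulrl_measurable.
pose k : {nonneg R} := NngNum (ltW c0).
rewrite (@lebesgue_measure_unique R
  (mscale k (pushforward (@lebesgue_measure R)
    ( *%R c : measurableTypeR R -> measurableTypeR R))))// => _ [[a b]] _ <-.
change (lebesgue_measure (`]a, b] : set R) =
  c%:E * lebesgue_measure (( *%R c) @^-1` `]a, b] : set R))%E.
have -> : ( *%R c) @^-1` `]a, b] = `]a / c, b / c]%classic.
  apply/seteqP; split => x /=; rewrite !in_itv/=;
    by rewrite ltr_pdivrMr// ler_pdivlMr// mulrC.
rewrite !lebesgue_measure_itv/= !lte_fin ltr_pM2r ?invr_gt0//.
case: ifPn => _; last by rewrite mule0.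
by rewrite -!EFinB -EFinM -mulrBl mulrC divfK ?gt_eqF.
Qed.

(** The substitution is made by rewriting the measure, so [f] need only be measurable; the
    integrands below contain the indicator of an arbitrary measurable set. *)
Lemma ge0_integralT_scale {R : realType} (c : R) (f : R -> \bar R) :
  0 < c -> measurable_fun [set: R] f -> (forall x, 0 <= f x)%E ->
  (\int[@lebesgue_measure R]_x f x =
   c%:E * \int[@lebesgue_measure R]_x f (c * x)%R)%E.
Proof.
move=> c0 mf f0.
have mc : measurable_fun [set: measurableTypeR R]
  ( *%R c : measurableTypeR R -> measurableTypeR R) by exact: mulrl_measurable.
pose k : {nonneg R} := NngNum (ltW c0).
rewrite (@eq_measure_integral _ _ _ _
  (mscale k (pushforward (@lebesgue_measure R)
    ( *%R c : measurableTypeR R -> measurableTypeR R)))); last first.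
  by move=> A mA _; exact: lebesgue_measure_scale.
rewrite ge0_integral_mscale//=; congr *%E.
by rewrite ge0_integral_pushforward.
Qed.

Lemma ge0_integralT_opp {R : realType} (f : R -> \bar R) :
  measurable_fun [set: R] f -> (forall x, 0 <= f x)%E ->
  (\int[@lebesgue_measure R]_x f x = \int[@lebesgue_measure R]_x f (- x)%R)%E.
Proof.
move=> mf f0.
have mc : measurable_fun [set: measurableTypeR R]
  (-%R : measurableTypeR R -> measurableTypeR R) by exact: oppr_measurable.
rewrite (@eq_measure_integral _ _ _ _
  (pushforward (@lebesgue_measure R)
    (-%R : measurableTypeR R -> measurableTypeR R))); last first.
  by move=> A mA _; exact/esym/lebesgue_measureN.
by rewrite ge0_integral_pushforward.
Qed.

Lemma ge0_integralT_scale_norm {R : realType} (c : R) (f : R -> \bar R) :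
  c != 0 -> measurable_fun [set: R] f -> (forall x, 0 <= f x)%E ->
  (\int[@lebesgue_measure R]_x f x =
   `|c|%:E * \int[@lebesgue_measure R]_x f (c * x)%R)%E.
Proof.
move=> + mf f0; rewrite neq_lt => /orP[c0|c0]; last first.
  by rewrite gtr0_norm//; exact: ge0_integralT_scale.
rewrite ltr0_norm// (@ge0_integralT_scale _ (- c))// ?oppr_gt0//; congr *%E.
rewrite [RHS]ge0_integralT_opp//; first by under eq_integral do rewrite mulNr -mulrN.
by apply: measurableT_comp => //; exact: mulrl_measurable.
Qed.

(** * Slope coordinates in the plane *)

(** Serves to discard x = 0, where the substitution y = x t degenerates. *)
Lemma integralT_neq0 {R : realType} (f g : R -> \bar R) :
  measurable_fun [set: R] f -> measurable_fun [set: R] g ->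
  (forall x, x != 0 -> f x = g x) ->
  (\int[@lebesgue_measure R]_x f x = \int[@lebesgue_measure R]_x g x)%E.
Proof.
move=> mf mg fg; apply: ae_eq_integral => //.
exists [set 0]; split => //; first exact: lebesgue_measure_set1.
move=> x /=; apply: contra_notP => /eqP x0 _; exact: fg.
Qed.

(* Replacing the polar angle by the slope t makes each step a linear
   substitution in one variable. *)
Lemma ge0_integral_slope {R : realType} (k : R * R -> \bar R) :
  measurable_fun [set: R * R] k -> (forall z, 0 <= k z)%E ->
  (\int[@lebesgue_measure R]_x \int[@lebesgue_measure R]_y k (x, y) =
   \int[@lebesgue_measure R]_u \int[@lebesgue_measure R]_t
     ((`|u| / (1 + t ^+ 2))%:E *
      k (u / Num.sqrt (1 + t ^+ 2), u * t / Num.sqrt (1 + t ^+ 2))%R))%E.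
Proof.
move=> mk k0.
(* [q t] is the cosine of the angle in (-pi/2, pi/2) with slope t. *)
pose q (t : R) := (Num.sqrt (1 + t ^+ 2))^-1.
have q0 t : 0 < q t by rewrite invr_gt0 sqrtr_gt0 ltr_wpDr ?sqr_ge0.
have q2 t : (1 + t ^+ 2)^-1 = q t * q t.
  by rewrite -invfM -expr2 sqr_sqrtr// ltW// ltr_wpDr ?sqr_ge0.
have cD (t : R) : (1 + x ^+ 2) @[x --> t] --> 1 + t ^+ 2.
  by apply: cvgD; [exact: cvg_cst|exact: exprn_continuous].
have mq : measurable_fun [set: R] q.
  apply: continuous_measurable_fun => t; apply: cvgV.
    by rewrite gt_eqF// sqrtr_gt0 ltr_wpDr ?sqr_ge0.
  by apply: (cvg_comp _ _ (cD t)); exact: sqrt_continuous.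
have m1 : measurable_fun [set: R * R] (fst : R * R -> R) by [].
have m2 : measurable_fun [set: R * R] (snd : R * R -> R) by [].
have mn : measurable_fun [set: R * R] (fun z : R * R => `|z.1|).
  exact: measurableT_comp.
have mq2 : measurable_fun [set: R * R] (fun z : R * R => q z.2).
  exact: measurableT_comp.
pose k1 (z : R * R) : \bar R := (`|z.1|%:E * k (z.1, z.1 * z.2)%R)%E.
have mk1 : measurable_fun [set: R * R] k1.
  apply: emeasurable_funM; first exact/measurable_EFinP.
  apply: measurableT_comp => //; apply: measurable_fun_pair => //.
  exact: measurable_funM.
have k10 z : (0 <= k1 z)%E by rewrite mule_ge0// lee_fin.
pose k2 (z : R * R) : \bar R :=
  ((`|z.1| * (q z.2 * q z.2))%:E * k (z.1 * q z.2, z.1 * z.2 * q z.2)%R)%E.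
have mk2 : measurable_fun [set: R * R] k2.
  apply: emeasurable_funM.
    by apply/measurable_EFinP; do 2 apply: measurable_funM => //.
  apply: measurableT_comp => //; apply: measurable_fun_pair => //.
    exact: measurable_funM.
  by do 2 apply: measurable_funM => //.
have k20 z : (0 <= k2 z)%E.
  by rewrite mule_ge0 ?lee_fin ?mulr_ge0 ?(ltW (q0 _)) ?normr_ge0.
(* For fixed x != 0, put y = x t; this contributes the factor |x|. *)
transitivity (\int[@lebesgue_measure R]_x \int[@lebesgue_measure R]_y k1 (x, y))%E.
  apply: integralT_neq0 => [||x x0].
  - exact: (measurable_fun_fubini_tonelli_F (m2 := @lebesgue_measure R) k).
  - exact: (measurable_fun_fubini_tonelli_F (m2 := @lebesgue_measure R) k1).
  have mx : measurable_fun [set: R] (fun y => k (x, y)).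
    exact: measurableT_comp mk (pair1_measurable x).
  rewrite (ge0_integralT_scale_norm _ _ x0)// -ge0_integralZl//.
  exact: measurableT_comp mx (@mulrl_measurable R setT x).
(* With t outermost, x = q(t) u is again a linear substitution. It contributes one factor q(t), and
   |x| = q(t) |u| contributes the other. *)
transitivity (\int[@lebesgue_measure R]_t \int[@lebesgue_measure R]_x k1 (x, t))%E.
  exact: (@fubini_tonelli _ _ _ _ _ (@lebesgue_measure R) (@lebesgue_measure R)).
transitivity (\int[@lebesgue_measure R]_t \int[@lebesgue_measure R]_u k2 (u, t))%E.
  apply: eq_integral => t _.
  have mt : measurable_fun [set: R] (fun x => k1 (x, t)).
    exact: measurableT_comp mk1 (pair2_measurable t).
  rewrite (ge0_integralT_scale _ _ (q0 t))// -ge0_integralZl//; last 2 first.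
  - exact: measurableT_comp mt (@mulrl_measurable R setT (q t)).
  - by rewrite lee_fin ltW.
  apply: eq_integral => u _; rewrite /k1 /k2/= muleA -EFinM normrM.
  rewrite (gtr0_norm (q0 t)); congr ((_)%:E * k (_, _))%E; ring.
transitivity (\int[@lebesgue_measure R]_u \int[@lebesgue_measure R]_t k2 (u, t))%E.
  exact/esym/(@fubini_tonelli _ _ _ _ _ (@lebesgue_measure R) (@lebesgue_measure R)).
by under eq_integral => u _ do under eq_integral => t _ do rewrite /k2/= -q2.
Qed.

(** The signed radius u reaches each spacing 2 |u| > 0 twice, and the factor 2 compensates: f(2 |x|)
    = f(2 x) + f(-2 x), where each term integrates to half the integral of f. *)
Lemma ge0_integral_double_norm {R : realType} (f : R -> \bar R) :
  measurable_fun [set: R] f -> (forall x, 0 <= f x)%E ->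
  (forall x, x <= 0 -> f x = 0%E) ->
  (\int[@lebesgue_measure R]_x f (2 * `|x|)%R = \int[@lebesgue_measure R]_x f x)%E.
Proof.
move=> mf f0 fN.
have m2 : measurable_fun [set: R] (fun x => f (2 * x)).
  exact: measurableT_comp mf (@mulrl_measurable R setT 2).
have mN : measurable_fun [set: R] (fun x => f (2 * - x)).
  exact: measurableT_comp m2 (@oppr_measurable R setT).
transitivity (\int[@lebesgue_measure R]_x (f (2 * x)%R + f (2 * - x)%R))%E.
  apply: eq_integral => x _; have [x0|x0] := leP 0 x.
    by rewrite ger0_norm// [X in (_ + X)%E]fN ?adde0//; lra.
  by rewrite ltr0_norm// [X in (X + _)%E]fN ?add0e//; lra.
rewrite ge0_integralD// -(ge0_integralT_opp _ m2)//.
rewrite (ge0_integralT_scale 2 f)//; set I := (\int[_]_x _)%E.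
have I0 : (0 <= I)%E by exact: integral_ge0.
by rewrite -[2%R]/(1 + 1)%R EFinD ge0_muleDl ?lee01// mul1e.
Qed.

(** * Integrals of Lorentzians *)

Lemma continuous_lorentz {R : realType} (c : R) :
  continuous (fun t : R => (1 + (c * t) ^+ 2)^-1).
Proof.
move=> t; apply: cvgV; first by rewrite gt_eqF// ltr_wpDr// sqr_ge0.
apply: cvgD; first exact: cvg_cst.
apply: (cvg_comp (fun x => c * x) (fun x => x ^+ 2)); last exact: exprn_continuous.
by apply: cvgM; [exact: cvg_cst|exact: cvg_id].
Qed.

Lemma lorentz_ge0 {R : realType} (x : R) : 0 <= (1 + x ^+ 2)^-1.
Proof. by rewrite invr_ge0 addr_ge0 ?sqr_ge0. Qed.

(** For c = 1, evenness doubles the half-line value pi / 2; scaling does the rest. *)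
Lemma integralT_lorentz {R : realType} (c : R) : 0 < c ->
  (\int[@lebesgue_measure R]_t ((1 + (c * t) ^+ 2)^-1)%:E = (pi / c)%:E)%E.
Proof.
move=> c0.
have cl : continuous (fun t : R => (1 + t ^+ 2)^-1).
  rewrite (_ : (fun _ => _) = fun t : R => (1 + (1 * t) ^+ 2)^-1).
    exact: continuous_lorentz.
  by apply/funext => t; rewrite mul1r.
have H : (\int[@lebesgue_measure R]_t ((1 + t ^+ 2)^-1)%:E = pi%:E)%E.
  rewrite (@ge0_symfun_integralT R (fun t => (1 + t ^+ 2)^-1)).
  - rewrite (_ : [set x | 0 <= x] = `[0%R, +oo[%classic); last first.
      by apply/seteqP; split => x /=; rewrite in_itv/= andbT.
    rewrite (_ : (\int[_]_(x in _) _)%E = (pi / 2)%:E); last exact: integral0y_oneDsqr.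
    by rewrite -EFinM mulrCA divff// mulr1.
  - by move=> x; exact: lorentz_ge0.
  - exact: cl.
  - by move=> x /=; rewrite sqrrN.
have m : measurable_fun [set: R] (EFin \o (fun t : R => (1 + t ^+ 2)^-1)).
  by apply/measurable_EFinP; exact: continuous_measurable_fun cl.
move: H; rewrite (ge0_integralT_scale c _ c0 m); last first.
  by move=> x; rewrite lee_fin lorentz_ge0.
move=> /(congr1 (fun x => (c^-1)%:E * x)%E).
by rewrite muleA -EFinM mulVf ?gt_eqF// mul1e -EFinM mulrC.
Qed.

Lemma integralT_lorentz2 {R : realType} (p q c d : R) :
  0 <= p -> 0 <= q -> 0 < c -> 0 < d ->
  (\int[@lebesgue_measure R]_t
     (p / (1 + (c * t) ^+ 2) + q / (1 + (d * t) ^+ 2))%:E =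
   (p * (pi / c) + q * (pi / d))%:E)%E.
Proof.
move=> p0 q0 c0 d0.
have m e : measurable_fun [set: R] (EFin \o (fun t : R => (1 + (e * t) ^+ 2)^-1)).
  by apply/measurable_EFinP; apply: continuous_measurable_fun; exact: continuous_lorentz.
under eq_integral do rewrite EFinD !EFinM.
rewrite ge0_integralD//=.
- rewrite !ge0_integralZl//=; first by rewrite !integralT_lorentz.
  + exact: m.
  + by move=> x _; rewrite lee_fin lorentz_ge0.
  + exact: m.
  + by move=> x _; rewrite lee_fin lorentz_ge0.
- by move=> x _; rewrite mule_ge0// lee_fin lorentz_ge0.
- by apply: measurable_funeM; exact: m.
- by move=> x _; rewrite mule_ge0// lee_fin lorentz_ge0.
- by apply: measurable_funeM; exact: m.
Qed.

(* The integrand splits as [(A / (1 + A + t^2) + B / (1 + (1 + B) t^2)) / D]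
   with [D = A + B + A B]. *)
Lemma integralT_lorentz_slope {R : realType} (K A B : R) :
  0 <= K -> 0 < A -> 0 < B ->
  (\int[@lebesgue_measure R]_t (K / (1 + t ^+ 2) *
     ((1 + A / (1 + t ^+ 2))^-1 * (1 + B * t ^+ 2 / (1 + t ^+ 2))^-1))%:E =
   (K * pi * (A / Num.sqrt (1 + A) + B / Num.sqrt (1 + B)) / (A + B + A * B))%:E)%E.
Proof.
move=> K0 A0 B0.
have AB0 : 0 < A * B by rewrite mulr_gt0.
have D0 : 0 < A + B + A * B by rewrite !addr_gt0.
have a0 : 0 < 1 + A by rewrite addr_gt0.
have b0 : 0 < 1 + B by rewrite addr_gt0.
have sa0 := sqrtr_gt0_oneD A (ltW A0); have sb0 := sqrtr_gt0_oneD B (ltW B0).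
have sa2 := sqr_sqrtr (ltW a0); have sb2 := sqr_sqrtr (ltW b0).
set sa := Num.sqrt _ in sa0 sa2 *; set sb := Num.sqrt _ in sb0 sb2 *.
(* Factoring 1 + A out of 1 + A + t^2 brings both terms to the form 1 + (c t)^2, with c = 1 / sqrt(1
   + A) and c = sqrt(1 + B). *)
transitivity (\int[@lebesgue_measure R]_t
   ((K * A / (1 + A) / (A + B + A * B)) / (1 + (sa^-1 * t) ^+ 2) +
    (K * B / (A + B + A * B)) / (1 + (sb * t) ^+ 2))%:E)%E.
  apply: eq_integral => t _; congr EFin.
  rewrite !exprMn exprVn sa2 sb2.
  have t2 := sqr_ge0 t; set x := t ^+ 2 in t2 *.
  have Bx : 0 <= B * x by rewrite mulr_ge0// ltW.
  field.
  by do ?[apply/andP; split]; apply: lt0r_neq0; lra.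
rewrite integralT_lorentz2 ?invr_gt0//; last 2 first.
- by rewrite !divr_ge0 ?mulr_ge0// ltW.
- by rewrite !divr_ge0 ?mulr_ge0// ltW.
congr EFin; rewrite invrK -sa2.
have p0 := pi_gt0 R; move: (pi : R) p0 => p p0.
by field; rewrite !gt_eqF.
Qed.

(** * Joint law of two independent variables with densities *)

(** Packages the integral as a measure, so that uniqueness of the product measure can be applied to
    it. *)
Lemma measure_with_density {d : measure_display} {T : measurableType d}
    {R : realType} (mu : {measure set T -> \bar R}) (h : T -> \bar R) :
  measurable_fun [set: T] h -> (forall x, 0 <= h x)%E ->
  exists nu : {measure set T -> \bar R},
    forall A, nu A = (\int[mu]_(x in A) h x)%E.
Proof.
move=> mh h0; pose nu A := (\int[mu]_(x in A) h x)%E.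
have nu0 : nu set0 = 0%E by rewrite /nu integral_set0.
have nu_ge0 A : (0 <= nu A)%E by exact: integral_ge0.
have nu_add : semi_sigma_additive nu.
  move=> F mF tF mUF; rewrite /nu ge0_integral_bigcup//; last first.
    exact: measurable_funS mh.
  by apply: is_cvg_ereal_nneg_natsum_cond => n _ _; exact: integral_ge0.
pose nuM := isMeasure.Build _ _ _ nu nu0 nu_ge0 nu_add.
pose nu' : {measure set T -> \bar R} := HB.pack nu nuM.
by exists nu'.
Qed.

Section joint_law.
Context {R : realType} {d : measure_display} {T : measurableType d}.
Variables (P : probability T R) (X Y : {RV P >-> R}) (f g : R -> R).
Hypotheses (XY : independent_RV P X Y).
Hypotheses (Xf : has_density P X f) (Yg : has_density P Y g).
Local Notation mu := (@lebesgue_measure R).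

Lemma measurable_joint_density (B : set (R * R)) : measurable B ->
  measurable_fun [set: R * R]
    (fun z : R * R => (\1_B z * (f z.1 * g z.2))%:E).
Proof.
move=> mB; have [_ mf _ _] := Xf; have [_ mg _ _] := Yg.
apply/measurable_EFinP; apply: measurable_funM; first exact: measurable_indic.
apply: measurable_funM.
  exact: measurableT_comp mf measurable_fst.
exact: measurableT_comp mg measurable_snd.
Qed.

(** The law of (X, Y), by independence, and the measure with density f(x) g(y), by factorisation,
    agree on rectangles with the product of the marginal laws; hence both equal it. *)
Lemma independent_joint_density (B : set (R * R)) : measurable B ->
  P [set w | B (X w, Y w)] =
  (\int[mu]_x \int[mu]_y (\1_B (x, y) * (f x * g y))%:E)%E.
Proof.
move=> mB.
have [mX mf f0 fE] := Xf; have [mY mg g0 gE] := Yg.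
pose h (z : measurableTypeR R * measurableTypeR R) : \bar R := (f z.1 * g z.2)%:E.
have mh : measurable_fun setT h.
  have := measurable_joint_density _ (@measurableT _ (R * R)%type).
  by under eq_fun do rewrite indicT mul1r.
have h0 z : (0 <= h z)%E by rewrite lee_fin mulr_ge0.
have [nu nuE] := measure_with_density (mu \x mu)%E _ mh h0.
have nu_indic (C : set (R * R)) : measurable C -> nu C =
    (\int[mu]_x \int[mu]_y (\1_C (x, y) * (f x * g y))%:E)%E.
  move=> mC; rewrite nuE integral_mkcond epatch_indic.
  transitivity (\int[mu \x mu]_z (\1_C z * (f z.1 * g z.2))%:E)%E.
    by apply: eq_integral => z _; rewrite /h/= EFinM muleC.
  apply: (@fubini_tonelli1 _ _ _ _ _ mu mu _ (measurable_joint_density _ mC)).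
  by move=> z; rewrite lee_fin !mulr_ge0.
(* [X'] and [Y'] are the same functions, with the codomain recast as the measurable space that
   carries [mu]. *)
pose X' : {mfun T >-> measurableTypeR R} :=
  HB.pack (X : T -> measurableTypeR R)
    (isMeasurableFun.Build _ _ T (measurableTypeR R) X mX).
pose Y' : {mfun T >-> measurableTypeR R} :=
  HB.pack (Y : T -> measurableTypeR R)
    (isMeasurableFun.Build _ _ T (measurableTypeR R) Y mY).
have mXY : measurable_fun setT (fun w => (X' w, Y' w)).
  exact: measurable_fun_pair.
pose Z : {mfun T >-> (measurableTypeR R * measurableTypeR R)%type} :=
  HB.pack (fun w => (X' w, Y' w)) (isMeasurableFun.Build _ _ _ _ _ mXY).
rewrite -(nu_indic _ mB).
transitivity ((distribution P X' \x distribution P Y')%E B).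
  symmetry; refine (@product_measure_unique _ _ _ _ _ (distribution P X')
    (distribution P Y') (distribution P Z) _ _ mB) => C D mC mD.
  exact: XY.
refine (@product_measure_unique _ _ _ _ _ (distribution P X')
    (distribution P Y') nu _ _ mB) => C D mC mD.
rewrite nu_indic; last exact: measurableX.
transitivity ((\int[mu]_(x in C) (f x)%:E) * (\int[mu]_(x in D) (g x)%:E))%E; last first.
  by rewrite -fE// -gE.
rewrite [X in (X * _)%E]integral_mkcond [X in (_ * X)%E]integral_mkcond !epatch_indic.
have m1 (E : set R) (k : R -> R) : measurable E -> measurable_fun setT k ->
    measurable_fun setT (fun x => (k x)%:E * (\1_E x)%:E)%E.
  move=> mE mk; apply: emeasurable_funM; apply/measurable_EFinP.
    exact: mk.
  exact: (@measurable_indic _ _ _ setT E mE).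
(* The indicator of C x D is a product, so the double integral factorises. *)
rewrite -ge0_integralZr//=.
- apply: eq_integral => x _; rewrite -ge0_integralZl//=.
  + apply: eq_integral => y _; rewrite -!EFinM; congr EFin.
    by rewrite !indicE in_setX/=; case: (_ \in C); case: (_ \in D) => /=; ring.
  + exact: m1.
  + by move=> y _; rewrite mule_ge0// lee_fin.
  + by rewrite mule_ge0// lee_fin.
- exact: m1.
- by move=> y _; rewrite mule_ge0// lee_fin.
- by apply: integral_ge0 => y _; rewrite mule_ge0// lee_fin.
Qed.

End joint_law.

(** * Law of the level spacing *)

Lemma cauchy_pdf_ge0 {R : realType} (c x : R) : 0 < c -> 0 <= cauchy_pdf c x.
Proof.
move=> c0; rewrite /cauchy_pdf div1r invr_ge0 mulr_ge0//.
  by rewrite mulr_ge0 ?pi_ge0// ltW.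
by rewrite addr_ge0// divr_ge0// sqr_ge0.
Qed.

(** This is the density of the signed radius u. The t integral yields a factor pi, which cancels one
    of the two in the product of the Cauchy normalisations. *)
Lemma integralT_cauchy_slope {R : realType} (a0 b0 u : R) :
  0 < a0 -> 0 < b0 -> u != 0 ->
  (\int[@lebesgue_measure R]_t (`|u| / (1 + t ^+ 2) *
     (cauchy_pdf a0 (u / Num.sqrt (1 + t ^+ 2)) *
      cauchy_pdf b0 (u * t / Num.sqrt (1 + t ^+ 2))))%:E =
   (spacing_pdf a0 b0 (2 * `|u|))%:E)%E.
Proof.
move=> a00 b00 u0.
have p0 := pi_gt0 R.
have u2 : 0 < u ^+ 2 by rewrite exprn_even_gt0.
have nu0 : 0 < `|u| by rewrite normr_gt0.
have a2 : 0 < a0 ^+ 2 by rewrite exprn_gt0.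
have b2 : 0 < b0 ^+ 2 by rewrite exprn_gt0.
(* u^2 / a0^2 and u^2 / b0^2 are alpha^2 and beta^2 at S = 2 |u|; they are positive since u != 0. *)
transitivity (\int[@lebesgue_measure R]_t
  ((`|u| / (pi ^+ 2 * a0 * b0)) / (1 + t ^+ 2) *
   ((1 + (u ^+ 2 / a0 ^+ 2) / (1 + t ^+ 2))^-1 *
    (1 + (u ^+ 2 / b0 ^+ 2) * t ^+ 2 / (1 + t ^+ 2))^-1))%:E)%E.
  apply: eq_integral => t _; congr EFin; rewrite /cauchy_pdf.
  have t2 := sqr_ge0 t.
  rewrite !expr_div_n sqr_sqrtr ?addr_ge0// exprMn.
  set x := t ^+ 2 in t2 *; set v := u ^+ 2 in u2 *.
  have vx : 0 <= v * x by rewrite mulr_ge0// ltW.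
  have ax : 0 <= a0 ^+ 2 * x by rewrite mulr_ge0// ltW.
  have bx : 0 <= b0 ^+ 2 * x by rewrite mulr_ge0// ltW.
  move: (pi : R) p0 => p p0; field.
  by do ?[apply/andP; split]; apply: lt0r_neq0 => //; lra.
rewrite integralT_lorentz_slope ?divr_gt0//; last first.
  by rewrite divr_ge0// !mulr_ge0 ?exprn_ge0 ?ltW.
congr EFin; rewrite /spacing_pdf.
have sE c : 0 < c -> (2 * `|u|) ^+ 2 / (4 * c ^+ 2) = u ^+ 2 / c ^+ 2.
  move=> c0; rewrite exprMn real_normK ?num_real//.
  by field; rewrite gt_eqF.
rewrite !sE//.
have sa0 := sqrtr_gt0_oneD _ (ltW (divr_gt0 u2 a2)).
have sb0 := sqrtr_gt0_oneD _ (ltW (divr_gt0 u2 b2)).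
set sa := Num.sqrt _ in sa0 *; set sb := Num.sqrt _ in sb0 *.
set n := `|u| in nu0 *; set v := u ^+ 2 in u2 *.
have va : 0 < v * a0 ^+ 2 by rewrite mulr_gt0.
have vb : 0 < v * b0 ^+ 2 by rewrite mulr_gt0.
move: (pi : R) p0 => p p0; clear sE; field.
have vv : 0 < v * v by exact: mulr_gt0.
have D0 : v * b0 ^+ 2 + v * a0 ^+ 2 + v * v != 0.
  by apply: lt0r_neq0; exact: addr_gt0 (addr_gt0 vb va) vv.
by rewrite D0 !gt_eqF.
Qed.

Lemma spacing_law {R : realType} {d : measure_display} {T : measurableType d}
    (P : probability T R) (a0 b0 : R) (a b : {RV P >-> R}) (A : set R) :
  0 < a0 -> 0 < b0 -> independent_RV P a b ->
  has_density P a (cauchy_pdf a0) -> has_density P b (cauchy_pdf b0) ->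
  measurable_fun [set: R] (fun s => if 0 < s then spacing_pdf a0 b0 s else 0) ->
  measurable A ->
  P [set w | A (2 * Num.sqrt (a w ^+ 2 + b w ^+ 2))] =
  (\int[@lebesgue_measure R]_(s in A)
     (if 0 < s then spacing_pdf a0 b0 s else 0)%:E)%E.
Proof.
move=> a00 b00 ab ha hb mpdf mA.
pose r (z : R * R) := 2 * Num.sqrt (z.1 ^+ 2 + z.2 ^+ 2).
have mr : measurable_fun [set: R * R] r.
  apply: measurable_funM; first exact: measurable_cst.
  apply: (@measurableT_comp _ _ _ _ _ _ (@Num.sqrt R)).
    by apply: continuous_measurable_fun; exact: sqrt_continuous.
  apply: measurable_funD; apply: measurable_funX; [exact: measurable_fst|exact: measurable_snd].
pose B : set (R * R) := r @^-1` A.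
have mB : measurable B by rewrite -[B]setTI; exact: mr.
pose k (z : R * R) := (\1_B z * (cauchy_pdf a0 z.1 * cauchy_pdf b0 z.2))%:E.
have mk : measurable_fun [set: R * R] k by exact: (measurable_joint_density _ _ _ _ _ ha hb).
have k0 z : (0 <= k z)%E.
  rewrite lee_fin; apply: mulr_ge0; first by rewrite indicE.
  by apply: mulr_ge0; exact: cauchy_pdf_ge0.
pose phi (s : R) : \bar R :=
  (\1_A s * (if 0 < s then spacing_pdf a0 b0 s else 0))%:E.
have mphi : measurable_fun [set: R] phi.
  by apply/measurable_EFinP; apply: measurable_funM => //; exact: measurable_indic.
have phi0 s : (0 <= phi s)%E.
  by rewrite lee_fin mulr_ge0//; case: ifPn => // s0; rewrite ltW// spacing_pdf_gt0.
transitivity (\int[@lebesgue_measure R]_s phi s)%E; last first.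
  rewrite [RHS]integral_mkcond epatch_indic; apply: eq_integral => s _.
  by rewrite /phi/= EFinM muleC.
(* Both sides become integrals over the signed radius u, to be compared for each u. *)
rewrite -(ge0_integral_double_norm phi)//; last first.
  by move=> x x0; rewrite /phi ltNge x0 mulr0.
rewrite (_ : P _ = \int[@lebesgue_measure R]_x \int[@lebesgue_measure R]_y k (x, y))%E; last first.
  exact: (independent_joint_density _ _ _ _ _ ab ha hb).
rewrite (ge0_integral_slope _ mk k0); apply: eq_integral => u _.
(* At u = 0 the Jacobian and [phi] both vanish. *)
have [->|u0] := eqVneq u 0.
  rewrite normr0 mulr0 /phi ltxx mulr0 integral0_eq// => t _.
  by rewrite mul0r mul0e.
(* The spacing does not depend on the slope, so the indicator is constant in the t integral. *)
have rE t : r (u / Num.sqrt (1 + t ^+ 2), u * t / Num.sqrt (1 + t ^+ 2)) = 2 * `|u|.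
  have t2 : 0 < 1 + t ^+ 2 by rewrite ltr_wpDr// sqr_ge0.
  rewrite /r/= !expr_div_n sqr_sqrtr ?ltW// exprMn -mulrDl.
  by rewrite -{1}[u ^+ 2]mulr1 -mulrDr mulfK ?gt_eqF// sqrtr_sqr.
have BE t : \1_B (u / Num.sqrt (1 + t ^+ 2), u * t / Num.sqrt (1 + t ^+ 2)) =
    \1_A (2 * `|u|) :> R by rewrite -(rE t).
rewrite /phi mulr_gt0 ?normr_gt0// /k; under eq_integral do rewrite BE.
rewrite indicE; case: (_ \in A); last first.
  by rewrite mul0r integral0_eq// => t _; rewrite mul0r mule0.
rewrite mul1r -(integralT_cauchy_slope _ _ _ a00 b00 u0).
by apply: eq_integral => t _; rewrite mul1r -EFinM.
Qed.

Theorem mainTheorem7 (R : realType) (d : measure_display)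
    (T : measurableType d) (P : probability T R)
    (a0 b0 : R) (ha0 : 0 < a0) (hb0 : 0 < b0)
    (a b : {RV P >-> R})
    (hab : independent_RV P a b)
    (ha : has_density P a (cauchy_pdf a0))
    (hb : has_density P b (cauchy_pdf b0)) :
  let S : T -> R := fun w => level_spacing (sym_traceless_mx (a w) (b w)) in
  [/\ forall w, S w = 2 * Num.sqrt (a w ^+ 2 + b w ^+ 2),
      has_density P S (fun s => if 0 < s then spacing_pdf a0 b0 s else 0),
      (spacing_pdf a0 b0 s / (4 * (a0 + b0) / (pi * s ^+ 2)))
        @[s --> +oo] --> (1 : R) &
      (\int[@lebesgue_measure R]_(s in `]0%R, +oo[)
         (s * spacing_pdf a0 b0 s)%:E = +oo)%E].
Proof.
move=> S; have SE w : S w = 2 * Num.sqrt (a w ^+ 2 + b w ^+ 2).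
  exact: level_spacing_sym_traceless.
have mpdf : measurable_fun [set: R]
    (fun s => if 0 < s then spacing_pdf a0 b0 s else 0).
  apply: measurable_fun_if => //.
  - exact: measurable_fun_ltr.
  - rewrite setTI (_ : _ @^-1` _ = `]0, +oo[%classic); last first.
      by apply/seteqP; split => s /=; rewrite in_itv/= andbT.
    exact: measurable_spacing_pdf.
split; [exact: SE| |exact: spacing_pdf_equiv|exact: spacing_pdf_moment_pinfty].
split; [|exact: mpdf| |].
(* Measurability is read off the closed form, as [S] itself is defined through [sup] and [inf]. *)
- rewrite (_ : S = fun w => 2 * Num.sqrt (a w ^+ 2 + b w ^+ 2)); last exact/funext.
  have [ma _ _ _] := ha; have [mb _ _ _] := hb.
  apply: measurable_funM; first exact: measurable_cst.
  apply: (@measurableT_comp _ _ _ _ _ _ (@Num.sqrt R)).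
    by apply: continuous_measurable_fun; exact: sqrt_continuous.
  by apply: measurable_funD; apply: measurable_funX.
- by move=> s; case: ifPn => // s0; rewrite ltW// spacing_pdf_gt0.
- move=> A mA; rewrite -(spacing_law _ _ _ _ _ _ ha0 hb0 hab ha hb mpdf mA).
  by congr (P _); apply/funext => w; rewrite /preimage/= SE.
Qed.
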